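(* Let $p,q>0$ be real numbers and let $\omega=ds\wedge dt$ be the standard symplectic form on $\mathbb{R}^2$. The maps $\mathfrak{m}_1$ and $\mathfrak{m}_2$ satisfy $\mathfrak{m}_1^*\omega=\mathfrak{m}_2^*\omega=-\omega$. Therefore the composition $\mathfrak{m}=\mathfrak{m}_2\circ\mathfrak{m}_1$ is symplectic, i.e. $\mathfrak{m}^*\omega=\omega$; equivalently, $\mathfrak{m}$ is a Poisson map for the bracket given by $\{s,t\}=1$.
   Context: Write $[x]_+=\max(x,0)$. For positive reals $p,q$, the maps $\mathfrak{m}_1,\mathfrak{m}_2:\mathbb{R}^2\to\mathbb{R}^2$ are $\mathfrak{m}_1(s,t)=(-s,\ t+p[s]_+)$ and $\mathfrak{m}_2(s,t)=(s+q[t]_+,\ -t)$. These maps are piecewise linear; pullback identities are understood on each domain of linearity (i.e. for each of the linear pieces defining the map). *)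

(* Defs.v *)
From mathcomp Require Import all_boot all_order all_algebra.
From mathcomp Require Import all_classical all_reals all_analysis.
Import Order.TTheory GRing.Theory Num.Theory.
Import numFieldNormedType.Exports.

Set Implicit Arguments.
Unset Strict Implicit.
Unset Printing Implicit Defensive.

Local Open Scope classical_set_scope.
Local Open Scope ring_scope.

Definition plane (R : realType) : normedModType R := (R^o * R^o)%type.

Definition coord_s (R : realType) (x : plane R) : R^o := x.1.
Definition coord_t (R : realType) (x : plane R) : R^o := x.2.

(* A differential k-form is a function of a base point and k tangent vectors. *)
Definition form1 (R : realType) := plane R -> plane R -> R.
Definition form2 (R : realType) := plane R -> plane R -> plane R -> R.

Definition dform (R : realType) (F : plane R -> R^o) : form1 R :=
  fun x v => 'd F x v.

Definition wedge (R : realType) (a b : form1 R) : form2 R :=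
  fun x u v => a x u * b x v - a x v * b x u.

Definition omega (R : realType) : form2 R :=
  wedge (dform (@coord_s R)) (dform (@coord_t R)).

Definition oppform (R : realType) (w : form2 R) : form2 R :=
  fun x u v => - w x u v.

Definition pullback (R : realType) (f : plane R -> plane R) (w : form2 R) :
  form2 R := fun x u v => w (f x) ('d f x u) ('d f x v).

Definition e_s (R : realType) : plane R := (1, 0).
Definition e_t (R : realType) : plane R := (0, 1).

(* The biderivation of the algebra of smooth functions with {s, t} = 1. *)
Definition bracket (R : realType) (F G : plane R -> R^o) : plane R -> R^o :=
  fun x => 'D_(e_s R) F x * 'D_(e_t R) G x - 'D_(e_t R) F x * 'D_(e_s R) G x.

Fixpoint Ck (R : realType) (k : nat) (F : plane R -> R^o) : Prop :=
  match k with
  | 0 => continuous F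
  | k'.+1 => (forall x, differentiable F x) /\
             forall v, Ck k' (fun x => 'd F x v)
  end.

Definition smooth (R : realType) (F : plane R -> R^o) : Prop :=
  forall k, Ck k F.

(* [f] agrees with the linear map [L] on [D]; the interior is required to be
   nonempty, since [L] is not determined by [f] on, say, a line. *)
Definition linear_piece (R : realType) (f : plane R -> plane R)
    (D : set (plane R)) (L : {linear plane R -> plane R}) : Prop :=
  interior D !=set0 /\ forall x, D x -> f x = L x.

Definition piecewise_linear (R : realType) (f : plane R -> plane R) : Prop :=
  exists (n : nat) (D : 'I_n -> set (plane R))
         (L : 'I_n -> {linear plane R -> plane R}),
    (forall i, closed (D i) /\ linear_piece f (D i) (L i)) /\
    (forall x, exists i, D i x).

(* A first-order condition [P f x] on a map [f] at a point [x], for [f]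
   piecewise linear: it is required of each linear piece at every point of its
   domain (boundary included, where [f] itself need not be differentiable), and
   of [f] itself in the interior of each domain. *)
Definition on_linear_pieces (R : realType)
    (P : (plane R -> plane R) -> plane R -> Prop)
    (f : plane R -> plane R) : Prop :=
  piecewise_linear f /\
  forall D (L : {linear plane R -> plane R}), linear_piece f D L ->
    (forall x, D x -> P L x) /\
    (forall x, interior D x -> differentiable f x /\ P f x).

(* f^* w = w' *)
Definition pulls_back (R : realType) (w w' : form2 R)
    (f : plane R -> plane R) : Prop :=
  on_linear_pieces
    (fun g x => forall u v, pullback g w x u v = w' x u v) f.

Definition symplectic (R : realType) (f : plane R -> plane R) : Prop :=
  pulls_back (@omega R) (@omega R) f.

Definition poisson_map (R : realType) (f : plane R -> plane R) : Prop :=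
  on_linear_pieces
    (fun g x => forall F G : plane R -> R^o, smooth F -> smooth G ->
       bracket (F \o g) (G \o g) x = bracket F G (g x)) f.

Definition pos_part (R : realType) (x : R) : R := Num.max x 0.

Definition m1 (R : realType) (p : R) (x : plane R) : plane R :=
  (- coord_s x, coord_t x + p * pos_part (coord_s x)).

Definition m2 (R : realType) (q : R) (x : plane R) : plane R :=
  (coord_s x + q * pos_part (coord_t x), - coord_t x).

Lemma is_diff_coord_s (R : realType) (x : plane R) :
  differentiable (@coord_s R) x /\ 'd (@coord_s R) x = fst :> (_ -> _).
Proof.
have c : continuous (@fst R^o R^o) by move=> y; exact: cvg_fst.
split; first exact: (@linear_differentiable _ _ _ (@fst R^o R^o)).
exact: (@diff_lin _ _ _ (@fst R^o R^o)).
Qed.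

Lemma is_diff_coord_t (R : realType) (x : plane R) :
  differentiable (@coord_t R) x /\ 'd (@coord_t R) x = snd :> (_ -> _).
Proof.
have c : continuous (@snd R^o R^o) by move=> y; exact: cvg_snd.
split; first exact: (@linear_differentiable _ _ _ (@snd R^o R^o)).
exact: (@diff_lin _ _ _ (@snd R^o R^o)).
Qed.

Lemma omegaE (R : realType) (x u v : plane R) :
  omega x u v = u.1 * v.2 - v.1 * u.2.
Proof.
by rewrite /omega /wedge /dform (is_diff_coord_s x).2 (is_diff_coord_t x).2.
Qed.

Lemma bracket_st (R : realType) (x : plane R) :
  bracket (@coord_s R) (@coord_t R) x = 1.
Proof.
have [ds dsE] := is_diff_coord_s x; have [dt dtE] := is_diff_coord_t x.
by rewrite /bracket !deriveE // dsE dtE /= mulr0 subr0 mulr1.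
Qed.

(* Main.v *)
(* On each closed half-plane cut out by the sign of the relevant coordinate, m1
   and m2 are linear of determinant -1, so the four pieces of m2 \o m1 are linear
   of determinant 1.  Any other linear piece (A, L) of such a map agrees with one
   of these: finitely many closed sets cover the interior of A, so one of them
   meets it in a set with nonempty interior, and linear maps that agree on such a
   set are equal.  On the plane, being symplectic and being Poisson both amount to
   the differential having determinant 1. *)

From HB Require Import structures.
Require Import Defs.
From mathcomp Require Import all_boot all_order all_algebra.
From mathcomp Require Import all_classical all_reals all_analysis.
From mathcomp Require Import ring.
Set Implicit Arguments.
Unset Strict Implicit.
Unset Printing Implicit Defensive.

Import Order.TTheory GRing.Theory Num.Theory.
Import numFieldNormedType.Exports.
Local Open Scope classical_set_scope.
Local Open Scope ring_scope.

(** * Finite closed covers and locally linear maps *)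

(** Induction on [n]: either [U] lies in [D ord0], or removing the closed set [D ord0] leaves a
    nonempty open set covered by the remaining ones. *)
Lemma interior_finite_cover (T : topologicalType) (n : nat)
    (D : 'I_n -> set T) (U : set T) :
  (forall i, closed (D i)) -> open U -> U !=set0 ->
  (forall x, U x -> exists i, D i x) ->
  exists i, interior (U `&` D i) !=set0.
Proof.
elim: n D U => [|n IHn] D U Dcl Uop [x Ux] Ucov.
  by have [[]] := Ucov x Ux.
have [[y [Uy nDy]]|nU] := pselect ((U `&` ~` D ord0) !=set0).
  have [i||||i [z Dz]] := IHn (D \o lift ord0) (U `&` ~` D ord0).
  - exact: Dcl.
  - by apply: openI => //; apply/closed_openC/Dcl.
  - by exists y.
  - move=> z [Uz nDz]; have [i Dz] := Ucov z Uz.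
    by case: (unliftP ord0 i) Dz => [j ->|->] // Dz; exists j.
  exists (lift ord0 i), z; move: Dz; rewrite /interior /=.
  by apply: filterS => w [[]].
exists ord0, x; apply: filterS (open_nbhs_nbhs (conj Uop Ux)) => z Uz.
by split=> //; apply: contrapT => nDz; apply: nU; exists z.
Qed.

Lemma linear_eq_on_interior (R : realType) (V W : normedModType R)
    (L M : {linear V -> W}) (A : set V) :
  interior A !=set0 -> (forall x, A x -> L x = M x) -> L =1 M.
Proof.
move=> [x Ax] LM v.
have cvx : (fun e : R => x + e *: v) @ (0 : R) --> x.
  rewrite -[X in _ --> X]addr0 -(scale0r v).
  by apply: cvgD; [exact: cvg_cst|apply: cvgZr_tmp; exact: cvg_id].
(* Punctured neighbourhoods of 0 supply a nonzero [e], which can then be cancelled from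
   [e *: L v = e *: M v]. *)
have [e [/= e0 Ae]] : exists e : R, e != 0 /\ A (x + e *: v).
  apply: (@filter_ex _ (0 : R)^').
  near=> e; split; first by near: e; exact: nbhs_dnbhs_neq.
  by near: e; apply: nbhs_dnbhs; exact: cvx.
have := LM _ Ae; rewrite !linearD !linearZ /= (LM x (interior_subset Ax)).
by move=> /addrI /(scalerI e0).
Unshelve. all: by end_near. Qed.

(** For small [h] the remainder [f (h + x) - f x - L h] vanishes exactly, so uniqueness of the
    differential gives [L]. *)
Lemma near_linear_diff (R : realType) (V W : normedModType R) (f : V -> W)
    (L : {linear V -> W}) (x : V) :
  continuous L -> (\forall y \near x, f y = L y) ->
  differentiable f x /\ 'd f x = L :> (V -> W).
Proof.
move=> Lc fL.
have fxL : f \o shift x = cst (f x) + L +o_ (0 : V) id.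
  apply/eqaddoP => e e0.
  have : \forall h \near (0 : V), f (h + x) = L (h + x).
    by move: fL; rewrite (near_shift 0) subr0.
  apply: filterS => h fh.
  rewrite !fctE /= fh (nbhs_singleton fL) linearD [L h + _]addrC subrr normr0.
  by rewrite mulr_ge0 // ltW.
have dfE := diff_unique Lc fxL.
by split=> //; apply/diff_locallyP; rewrite dfE.
Qed.

Section Plane.
Context {R : realType}.
Implicit Types (L M : {linear plane R -> plane R}) (f g : plane R -> plane R).

Lemma plane_linearE (V : lmodType R) (L : {linear plane R -> V}) (u : plane R) :
  L u = u.1 *: L (e_s R) + u.2 *: L (e_t R).
Proof.
rewrite -!linearZ -linearD; congr (L _); case: u => a b.
by congr (_, _); rewrite /= /GRing.scale /= !(mulr1, mulr0) ?addr0 ?add0r.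
Qed.

Lemma plane_linear_continuous L : continuous L.
Proof.
rewrite (_ : (L : _ -> _) =
  fun u : plane R => u.1 *: L (e_s R) + u.2 *: L (e_t R)).
  move=> u; apply: cvgD; apply: cvgZr_tmp; [exact: cvg_fst|exact: cvg_snd].
by apply/funext => u; exact: plane_linearE.
Qed.

(** * Linear atlases and first-order conditions on pieces *)

(** For linear [f] this says that the determinant is [k]. *)
Definition scales_area (k : R) f :=
  forall x u v, omega x (f u) (f v) = k * omega x u v.

(** An arbitrary finite index type lets pieces be labelled by signs, or by pairs of signs for a
    composition. *)
Definition linear_atlas (I : finType) f (D : I -> set (plane R))
    (L : I -> {linear plane R -> plane R}) :=
  (forall i, closed (D i) /\ linear_piece f (D i) (L i)) /\
  (forall x, exists i, D i x).

Lemma linear_piece_atlas (n : nat) f (D : 'I_n -> set (plane R))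
    (L' : 'I_n -> {linear plane R -> plane R}) A L :
  linear_atlas f D L' -> linear_piece f A L -> exists i, L =1 L' i.
Proof.
move=> [DL Dcov] [A0 fL].
have [i||||i [x Dx]] := interior_finite_cover (D := D) (U := interior A).
- by case: (DL i).
- exact: open_interior.
- by [].
- by move=> x _; exact: Dcov.
exists i; apply: (linear_eq_on_interior (A := interior A `&` D i)).
  by exists x.
move=> y [/interior_subset Ay Dy]; rewrite -fL //.
by case: (DL i) => _ [_ ->].
Qed.

(** Reduces the symplectic and Poisson conditions alike to one pointwise implication from the
    determinant of the differential. *)
Lemma on_linear_pieces_atlas (I : finType) f (D : I -> set (plane R))
    (L : I -> {linear plane R -> plane R}) (k : R)
    (P : (plane R -> plane R) -> plane R -> Prop) :
  linear_atlas f D L -> (forall i, scales_area k (L i)) ->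
  (forall g x, differentiable g x -> scales_area k ('d g x) -> P g x) ->
  on_linear_pieces P f.
Proof.
move=> [DL Dcov] Lk Pk.
have atl : linear_atlas f (D \o @enum_val I predT) (L \o @enum_val I predT).
  split=> [i|x]; first exact: DL.
  by have [i Dx] := Dcov x; exists (enum_rank i); rewrite /= enum_rankK.
split; first by exists #|I|, (D \o @enum_val I predT), (L \o @enum_val I predT).
move=> A M AM; have [i /funext Mi] := linear_piece_atlas atl AM.
have Mk : scales_area k M by rewrite Mi; exact: Lk.
(* Serves twice: for [g = M] at every point of [A], and for [g = f] at interior points. *)
have Pnear g x : (\forall y \near x, g y = M y) -> differentiable g x /\ P g x.
  move=> gM.
  have [dg dgE] := near_linear_diff (@plane_linear_continuous M) gM.
  by split=> //; apply: Pk; rewrite ?dgE.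
split=> x Ax; first by have [] := Pnear M x (filterE _ (fun=> erefl)).
by apply: Pnear; apply: filterS Ax => y; exact: AM.2.
Qed.

Lemma pulls_back_atlas (I : finType) f (D : I -> set (plane R))
    (L : I -> {linear plane R -> plane R}) (k : R) (w : form2 R) :
  linear_atlas f D L -> (forall i, scales_area k (L i)) ->
  (forall x u v, w x u v = k * omega x u v) ->
  pulls_back (@omega R) w f.
Proof.
move=> DL Lk wE; apply: (on_linear_pieces_atlas DL Lk).
(* [omega] has constant coefficients, so its values at [g x] and at [x] agree. *)
by move=> g x _ gk u v; rewrite wE -gk /pullback !omegaE.
Qed.

(** By the chain rule the left side is the Jacobian determinant of [g] at [x] times the bracket at
    [g x]. *)
Lemma bracket_scales_area (k : R) g (F G : plane R -> R^o) (x : plane R) :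
  differentiable g x -> scales_area k ('d g x) ->
  differentiable F (g x) -> differentiable G (g x) ->
  bracket (F \o g) (G \o g) x = k * bracket F G (g x).
Proof.
move=> dg gk.
have chain (H : plane R -> R^o) (u : plane R) : differentiable H (g x) ->
    'D_u (H \o g) x = ('d g x u).1 * 'D_(e_s R) H (g x)
                    + ('d g x u).2 * 'D_(e_t R) H (g x).
  move=> dH.
  have dHg : differentiable (H \o g) x by exact: differentiable_comp.
  rewrite (deriveE _ dHg) (deriveE _ dH) (deriveE _ dH).
  (* Rewriting with [diff_comp] diverges: its redex unifies with any ['d]. *)
  apply: etrans (congr1 (@^~ u) (diff_comp dg dH)) _.
  exact: (plane_linearE ('d H (g x)) ('d g x u)).
move=> /[dup] /chain dF1 /chain dF2 /[dup] /chain dG1 /chain dG2.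
rewrite /bracket dF1 dF2 dG1 dG2.
(* Since [omega] is 1 on the standard basis, [k] is the determinant of ['d g x] in coordinates. *)
have := gk x (e_s R) (e_t R); rewrite !omegaE /= mul0r subr0 !mulr1 => <-.
ring.
Qed.

Lemma poisson_map_atlas (I : finType) f (D : I -> set (plane R))
    (L : I -> {linear plane R -> plane R}) :
  linear_atlas f D L -> (forall i, scales_area 1 (L i)) -> poisson_map f.
Proof.
move=> DL L1; apply: (on_linear_pieces_atlas DL L1).
(* Smoothness at order 1 provides differentiability of [F] and [G]. *)
move=> g x dg g1 F G /(_ 1%N)[dF _] /(_ 1%N)[dG _].
by rewrite (bracket_scales_area dg g1) // mul1r.
Qed.

(** * Half-planes given by a sign *)

Definition half_line (a : bool) : set R := [set x | 0 <= (-1) ^+ a * x].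

Lemma half_line_cover (x : R) : exists a, half_line a x.
Proof.
have [x0|x0] := leP 0 x; first by exists false; rewrite /half_line /= mul1r.
by exists true; rewrite /half_line /= mulN1r oppr_ge0 ltW.
Qed.

Lemma pos_partE (a : bool) (x : R) :
  half_line a x -> pos_part x = (~~ a)%:R * x.
Proof.
case: a; rewrite /half_line /pos_part /=.
  by rewrite expr1 mulN1r oppr_ge0 mul0r => /max_r.
by rewrite expr0 !mul1r => /max_l.
Qed.

Lemma closed_half_plane (T : topologicalType) (F : T -> R) (a : bool) :
  continuous F -> closed (F @^-1` half_line a).
Proof.
move=> Fc.
apply: (@preimage_closed _ R (fun x => (-1) ^+ a * F x) [set y | 0 <= y]).
  by move=> x _; apply: cvgMl_tmp; exact: Fc.
exact: (@closed_ge R 0).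
Qed.

(** Gives domains nonempty interior: at such a point the signed value is 1, and strict positivity is
    an open condition. *)
Lemma nbhs_half_plane (T : topologicalType) (F : T -> R) (a : bool) (x : T) :
  continuous F -> F x = (-1) ^+ a -> \forall y \near x, half_line a (F y).
Proof.
move=> Fc Fx.
have Gc : continuous (fun x => (-1) ^+ a * F x).
  by move=> y; apply: cvgMl_tmp; exact: Fc.
have Gx : 0 < (-1) ^+ a * F x by rewrite Fx -signr_addb addbb.
have : \forall y \near x, 0 < (-1) ^+ a * F y.
  exact: Gc x _ (open_nbhs_nbhs (conj (@open_gt R 0) Gx)).
by apply: filterS => y /= /ltW.
Qed.

Lemma coord_s_continuous : continuous (@coord_s R).
Proof. by move=> x; exact: cvg_fst. Qed.

Lemma coord_t_continuous : continuous (@coord_t R).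
Proof. by move=> x; exact: cvg_snd. Qed.

(** * The linear pieces of [m1], [m2] and their composition *)

(** The factor [(~~ a)%:R] is the slope of [pos_part] on [half_line a]. *)
Definition m1_piece (p : R) (a : bool) (x : plane R) : plane R :=
  (- x.1, x.2 + p * (~~ a)%:R * x.1).

Definition m2_piece (q : R) (b : bool) (x : plane R) : plane R :=
  (x.1 + q * (~~ b)%:R * x.2, - x.2).

Fact m1_piece_linear (p : R) (a : bool) : linear (m1_piece p a).
Proof. by move=> k u v; congr (_, _); rewrite /= /GRing.scale /=; ring. Qed.

Fact m2_piece_linear (q : R) (b : bool) : linear (m2_piece q b).
Proof. by move=> k u v; congr (_, _); rewrite /= /GRing.scale /=; ring. Qed.

HB.instance Definition _ (p : R) (a : bool) :=
  GRing.isLinear.Build R (plane R) (plane R) *:%R (m1_piece p a)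
    (m1_piece_linear p a).

HB.instance Definition _ (q : R) (b : bool) :=
  GRing.isLinear.Build R (plane R) (plane R) *:%R (m2_piece q b)
    (m2_piece_linear q b).

Lemma m1_pieceE (p : R) (a : bool) (x : plane R) :
  half_line a (coord_s x) -> m1 p x = m1_piece p a x.
Proof. by move=> /pos_partE xa; rewrite /m1 xa mulrA. Qed.

Lemma m2_pieceE (q : R) (b : bool) (x : plane R) :
  half_line b (coord_t x) -> m2 q x = m2_piece q b x.
Proof. by move=> /pos_partE xb; rewrite /m2 xb mulrA. Qed.

(** The sign of this function selects the piece of [m2] applied after [m1]. *)
Lemma m1_continuous_t (p : R) : continuous (@coord_t R \o m1 p).
Proof.
move=> x; apply: cvgD; first exact: coord_t_continuous.
apply: cvgMl_tmp; apply: (continuous_max (f := @coord_s R) (g := cst (0 : R))).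
  exact: coord_s_continuous.
exact: cvg_cst.
Qed.

Lemma scales_area_m1_piece (p : R) (a : bool) : scales_area (-1) (m1_piece p a).
Proof. by move=> x u v; rewrite !omegaE /=; ring. Qed.

Lemma scales_area_m2_piece (q : R) (b : bool) : scales_area (-1) (m2_piece q b).
Proof. by move=> x u v; rewrite !omegaE /=; ring. Qed.

Lemma m1_atlas (p : R) :
  linear_atlas (m1 p) (fun a => @coord_s R @^-1` half_line a) (m1_piece p).
Proof.
split=> [a|x]; last exact: half_line_cover.
split; first exact: closed_half_plane coord_s_continuous.
split; last by move=> x; exact: m1_pieceE.
by exists ((-1) ^+ a, 0); exact: nbhs_half_plane coord_s_continuous _.
Qed.

Lemma m2_atlas (q : R) :
  linear_atlas (m2 q) (fun b => @coord_t R @^-1` half_line b) (m2_piece q).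
Proof.
split=> [b|x]; last exact: half_line_cover.
split; first exact: closed_half_plane coord_t_continuous.
split; last by move=> x; exact: m2_pieceE.
by exists (0, (-1) ^+ b); exact: nbhs_half_plane coord_t_continuous _.
Qed.

Lemma m2_m1_atlas (p q : R) :
  linear_atlas (m2 q \o m1 p)
    (fun ab : bool * bool => @coord_s R @^-1` half_line ab.1 `&`
       (@coord_t R \o m1 p) @^-1` half_line ab.2)
    (fun ab => m2_piece q ab.2 \o m1_piece p ab.1).
Proof.
split=> [[a b]|x] /=; last first.
  have [a xa] := half_line_cover (coord_s x).
  by have [b xb] := half_line_cover (coord_t (m1 p x)); exists (a, b).
split.
  apply: closedI; first exact: closed_half_plane coord_s_continuous.
  apply: (closed_half_plane (F := coord_t (R := R) \o m1 p)).
  exact: m1_continuous_t.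
split; last by move=> x [/= xa xb]; rewrite -m1_pieceE // -m2_pieceE.
(* The second coordinate is chosen so that [m1 p] sends it to [(-1) ^+ b]. *)
exists ((-1) ^+ a, (-1) ^+ b - p * pos_part ((-1) ^+ a)).
apply: filterI; first exact: nbhs_half_plane coord_s_continuous _.
apply: (nbhs_half_plane (F := coord_t (R := R) \o m1 p)).
  exact: m1_continuous_t.
by rewrite /= /coord_t /= subrK.
Qed.

End Plane.

Theorem proposition3p1 (R : realType) (p q : R) (hp : 0 < p) (hq : 0 < q) :
  pulls_back (@omega R) (oppform (@omega R)) (m1 p) /\
  pulls_back (@omega R) (oppform (@omega R)) (m2 q) /\
  symplectic (m2 q \o m1 p) /\
  poisson_map (m2 q \o m1 p).
Proof.
have area1 (ab : bool * bool) :
    scales_area 1 (m2_piece q ab.2 \o m1_piece p ab.1).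
  move=> x u v; rewrite /= scales_area_m2_piece scales_area_m1_piece.
  by rewrite mulrA mulrNN !mul1r.
split; first apply: (pulls_back_atlas (k := -1) (m1_atlas p)).
- exact: scales_area_m1_piece.
- by move=> x u v; rewrite mulN1r.
split; first apply: (pulls_back_atlas (k := -1) (m2_atlas q)).
- exact: scales_area_m2_piece.
- by move=> x u v; rewrite mulN1r.
split; last exact: poisson_map_atlas (m2_m1_atlas p q) area1.
apply: (pulls_back_atlas (m2_m1_atlas p q) area1).
by move=> x u v; rewrite mul1r.
Qed.
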